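(* Let $\{X_k : k \geq 1\}$ be independent random variables, each uniformly distributed in $(0,1)$, and let $$\Omega_{\text{rand},\text{lac}} := \left\{ \frac{\pi X_k}{2^k} : k \geq 1\right\}.$$ Then the Perron's capacity of $\Omega_{\text{rand},\text{lac}}$ is finite almost surely, i.e. almost surely $$P(\Omega_{\text{rand},\text{lac}}) < \infty.$$
   Context: For a set of directions $\Omega \subset (0,\pi)$ (directions are identified with angles), let $\Omega^{-1} := \{ \pi/u : u \in \Omega\}$. For a finite set of real numbers $U = \{u_1 < u_2 < \dots < u_{2^N}\}$ of cardinality $2^N$, define its Perron's factor $$G(U) := \sup_{\substack{k,l \geq 1\\ k+2l \leq 2^N}} \left( \frac{u_{k+2l} - u_{k+l}}{u_{k+l} - u_{k}} + \frac{u_{k+l} - u_{k}}{u_{k+2l} - u_{k+l}} \right),$$ with $k,l$ integers. The Perron's capacity of $\Omega$ is $$P(\Omega) := \liminf_{N \to \infty} \ \inf_{\substack{U \subset \Omega^{-1}\\ \#U = 2^N}} G(U) \in [2,\infty].$$ *)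

(* Defs.v *)
From HB Require Import structures.
From mathcomp Require Import all_boot all_order all_algebra finmap.
From mathcomp Require Import all_classical all_reals all_analysis.
Set Implicit Arguments.
Unset Strict Implicit.
Unset Printing Implicit Defensive.
Import Order.TTheory GRing.Theory Num.Theory.

Local Open Scope classical_set_scope.
Local Open Scope ring_scope.

Definition dir_inv (R : realType) (Omega : set R) : set R :=
  [set pi / u | u in Omega].

(* [elt U k] is the k-th smallest element of U, counted from k = 1;
   it is 0 when k exceeds the cardinality of U. *)
Definition elt (R : realType) (U : {fset R}) (k : nat) : R :=
  nth 0 (sort <=%R (enum_fset U)) k.-1.

(* The supremum is taken in \bar R, so it is -oo when U has at most two
   elements (no admissible pair); this affects only N = 0 and N = 1 below. *)
Definition perron_factor (R : realType) (U : {fset R}) : \bar R :=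
  ereal_sup
    [set (let: (k, l) := kl in
          (elt U (k + 2 * l) - elt U (k + l)) / (elt U (k + l) - elt U k) +
          (elt U (k + l) - elt U k) / (elt U (k + 2 * l) - elt U (k + l)))%:E
    | kl in [set kl : nat * nat |
             [&& (1 <= kl.1)%N, (1 <= kl.2)%N &
                 (kl.1 + 2 * kl.2 <= #|` U|)%N]]].

(* The infimum is taken in \bar R, so it is +oo when [dir_inv Omega] has no
   subset with 2 ^ N elements. *)
Definition perron_capacity (R : realType) (Omega : set R) : \bar R :=
  limn_einf (fun N : nat =>
    ereal_inf [set perron_factor U | U in [set U : {fset R} |
      [set` U] `<=` dir_inv Omega /\ #|` U| = (2 ^ N)%N]]).

(* Mutual independence of the subfamily (X i), i in D. *)
Definition independent_RVs (d : measure_display) (T : measurableType d)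
    (R : realType) (P : probability T R) (I : choiceType) (D : set I)
    (X : I -> {RV P >-> R}) : Prop :=
  forall (J : {fset I}) (B : I -> set R),
    [set` J] `<=` D -> (forall i, i \in J -> measurable (B i)) ->
    P (\bigcap_(i in [set` J]) (X i @^-1` B i)) =
    (\prod_(i <- enum_fset J) P (X i @^-1` B i))%E.

(* [uniform_prob] lives on [0, 1]; the endpoints are null, so this is the
   uniform law on (0, 1), and X may leave (0, 1) on a null event. *)
Definition uniform01 (d : measure_display) (T : measurableType d)
    (R : realType) (P : probability T R) (X : {RV P >-> R}) : Prop :=
  forall A : set R, measurable A ->
    distribution P X A = uniform_prob (@ltr01 R) A.

Definition Omega_rand_lac (R : realType) (x : nat -> R) : set R :=
  [set pi * x k / 2 ^+ k | k in [set k : nat | (1 <= k)%N]].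

(* Main.v *)
Require Import Defs.
From HB Require Import structures.
From mathcomp Require Import all_boot all_order all_algebra finmap.
From mathcomp Require Import all_classical all_reals all_analysis.
From mathcomp Require Import ring lra zify.
Import Order.TTheory GRing.Theory Num.Theory.
Import numFieldNormedType.Exports.

(** The inverted set consists of the points 2^k / X_k.  Perron's factor is
    bounded on any perturbed arithmetic progression: if the i-th point lies in
    c [i, i + 1/2], the two lengths compared in the factor both lie in
    c [l - 1/2, l + 1/2], so their ratio is at most 3 and the factor is at
    most 6, however many points there are ([perron_factor_near_AP]).  It is
    therefore enough to find, for every N, such a progression with 2^N terms
    among the points 2^k / X_k.

    Write n = 2^N and look at the n consecutive indices m + 1, ..., m + n.  The
    points 2^(m+i) / X_(m+i) form a perturbed progression with
    c = 2^(m+n) as soon as 2^i / X_(m+i) lies in 2^n [i, i + 1/2] for all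
    1 <= i <= n, that is, as soon as X_(m+i) lies in an interval that depends on
    n and i only ([window]).  The factor 2^n puts these intervals inside [0, 1],
    so the event has a positive probability which does not depend on m.  Over
    the disjoint blocks m = 0, n, 2n, ... these events are independent, hence
    almost surely one of them occurs ([ae_some_event]).  Since there are
    countably many N, almost surely this happens for all N at once, and the
    capacity is at most 6. *)

Local Open Scope classical_set_scope.
Local Open Scope ring_scope.

(** * Perron's factor of perturbed arithmetic progressions *)

Section PerturbedProgressions.
Context {R : realType}.

(** Only differences enter Perron's factor, so the condition is on differences
    and leaves the first term free. *)
Definition near_AP (u : nat -> R) (n : nat) (c : R) : Prop :=
  forall i j, (i < j)%N -> (j < n)%N ->
    c * ((j - i)%:R - 2^-1) <= u j - u i <= c * ((j - i)%:R + 2^-1).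

Lemma near_AP_lt (u : nat -> R) n c : 0 < c -> near_AP u n c ->
  forall i j, (i < j)%N -> (j < n)%N -> u i < u j.
Proof.
move=> c0 uc i j ij jn; have /andP[h _] := uc i j ij jn.
rewrite -subr_gt0; apply: lt_le_trans h; apply: mulr_gt0 => //.
have : 1%:R <= (j - i)%:R :> R by rewrite ler_nat subn_gt0.
lra.
Qed.

Lemma uniq_increasing (u : nat -> R) n :
  (forall i j, (i < j)%N -> (j < n)%N -> u i < u j) -> uniq (mkseq u n).
Proof.
move=> incu; rewrite map_inj_in_uniq ?iota_uniq// => i j.
rewrite !mem_iota !add0n => /andP[_ ilt] /andP[_ jlt] uij.
case: (ltngtP i j) => // /incu; rewrite uij ltxx.
  by move=> /(_ jlt).
by move=> /(_ ilt).
Qed.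

Lemma card_increasing (u : nat -> R) n :
  (forall i j, (i < j)%N -> (j < n)%N -> u i < u j) ->
  #|` [fset x in mkseq u n]%fset| = n.
Proof.
by move=> incu; rewrite card_fseq undup_id ?size_mkseq//; exact: uniq_increasing.
Qed.

Lemma elt_increasing (u : nat -> R) n :
  (forall i j, (i < j)%N -> (j < n)%N -> u i < u j) ->
  forall k, (1 <= k <= n)%N -> elt [fset x in mkseq u n]%fset k = u k.-1.
Proof.
move=> incu k /andP[k1 kn].
have us := uniq_increasing _ _ incu.
rewrite /elt.
have -> : sort <=%R (enum_fset [fset x in mkseq u n]%fset) = mkseq u n.
  apply: le_sorted_eq; rewrite ?sort_le_sorted//.
    apply/(sortedP 0) => i; rewrite size_mkseq => iLn.
    by rewrite !nth_mkseq ?(ltnW iLn)//; exact/ltW/incu.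
  apply: uniq_perm => //; first by rewrite sort_uniq fset_uniq.
  by move=> x; rewrite mem_sort; exact: in_fset.
by rewrite nth_mkseq//; lia.
Qed.

(** Both lengths in the factor lie in c [l - 1/2, l + 1/2], and l + 1/2 is at
    most 3 (l - 1/2) because l >= 1; this is where the tolerance 1/2 is used. *)
Lemma perron_factor_near_AP (u : nat -> R) n c : 0 < c -> near_AP u n c ->
  (perron_factor [fset x in mkseq u n]%fset <= 6%:E)%E.
Proof.
move=> c0 uc; have incu := near_AP_lt _ _ _ c0 uc.
apply: ge_ereal_sup => x [[k l] /= /and3P[k1 l1]].
rewrite card_increasing// => kln <-{x}; rewrite lee_fin.
rewrite !(elt_increasing _ _ incu); try lia.
have := uc k.-1 (k + l).-1; have := uc (k + l).-1 (k + 2 * l).-1.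
have -> : ((k + l).-1 - k.-1)%N = l by lia.
have -> : ((k + 2 * l).-1 - (k + l).-1)%N = l by lia.
set y := u (k + 2 * l).-1 - _; set x := u (k + l).-1 - _.
move=> /(_ ltac:(lia) ltac:(lia)) /andP[y1 y2].
move=> /(_ ltac:(lia) ltac:(lia)) /andP[x1 x2].
have cl : c <= c * l%:R by rewrite ler_peMr ?ler1n// ltW.
have x0 : 0 < x by lra.
have y0 : 0 < y by lra.
have -> : (6 : R) = 3 + 3 by lra.
by apply: lerD; rewrite ler_pdivrMr//; lra.
Qed.

Lemma perron_capacity_le (Omega : set R) (C : \bar R) :
  (forall N, exists U : {fset R}, [/\ [set` U] `<=` dir_inv Omega,
    #|` U| = (2 ^ N)%N & (perron_factor U <= C)%E]) ->
  (perron_capacity Omega <= C)%E.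
Proof.
move=> hU; rewrite /perron_capacity limn_einf_lim.
apply: lime_le; first exact: is_cvg_einfs.
apply: nearW => N.
have [U [UO cU GU]] := hU N.
apply: (le_trans _ GU); rewrite /einfs/=.
apply: (@le_trans _ _ (ereal_inf [set perron_factor U | U in [set U : {fset R} |
      [set` U] `<=` dir_inv Omega /\ #|` U| = (2 ^ N)%N]])).
  by apply: ereal_inf_lbound; exists N => /=.
by apply: ereal_inf_lbound; exists U.
Qed.

End PerturbedProgressions.

(** * Windows that force a perturbed progression *)

Section Windows.
Context {R : realType}.

(** The solution set of 2^(i+1) / x in 2^n [i + 1, i + 3/2]; the (i+1)-st
    variable of a block has to fall into it. *)
Definition window (n i : nat) : set R :=
  `[2 ^+ i.+1 / (2 ^+ n * (i.+1%:R + 2^-1)), 2 ^+ i.+1 / (2 ^+ n * i.+1%:R)]%classic.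

Lemma windowP n i x : window n i x ->
  0 < x /\ 2 ^+ n * i.+1%:R <= 2 ^+ i.+1 / x <= 2 ^+ n * (i.+1%:R + 2^-1).
Proof.
rewrite /window/= in_itv/= => /andP[lx xu].
have p0 : 0 < 2 ^+ n :> R by rewrite exprn_gt0.
have q0 : 0 < 2 ^+ i.+1 :> R by rewrite exprn_gt0.
have i0 : 0 < i.+1%:R :> R by rewrite ltr0n.
have b0 : 0 < 2 ^+ n * i.+1%:R :> R by rewrite mulr_gt0.
have a0 : 0 < 2 ^+ n * (i.+1%:R + 2^-1) :> R by rewrite mulr_gt0//; lra.
have x0 : 0 < x by apply: lt_le_trans lx; rewrite divr_gt0.
split=> //; rewrite ler_pdivlMr// ler_pdivrMr//.
by rewrite ler_pdivrMr// in lx; rewrite ler_pdivlMr// in xu; rewrite mulrC xu mulrC lx.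
Qed.

(** The scale 2^m of the block factors out of all its points, which is why the
    windows need not depend on m. *)
Lemma near_AP_windows (x : nat -> R) (n m : nat) :
  (forall i, (i < n)%N -> window n i (x (m + i.+1)%N)) ->
  near_AP (fun i => 2 ^+ (m + i.+1) / x (m + i.+1)%N) n (2 ^+ (m + n)).
Proof.
move=> xw i j ij jn.
have [_ /andP[j1 j2]] := windowP _ _ _ (xw _ jn).
have [_ /andP[i1 i2]] := windowP _ _ _ (xw _ (ltn_trans ij jn)).
rewrite !exprD -!mulrA -mulrBr !ler_pM2l ?exprn_gt0//.
rewrite -(natr1 j) in j1 j2; rewrite -(natr1 i) in i1 i2.
rewrite natrB ?(ltnW ij)//.
by apply/andP; split; lra.
Qed.

Lemma perron_capacity_windows (x : nat -> R) :
  (forall N, exists m, forall i, (i < 2 ^ N)%N -> window (2 ^ N) i (x (m + i.+1)%N)) ->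
  (perron_capacity (Omega_rand_lac x) <= 6%:E)%E.
Proof.
move=> hx; apply: perron_capacity_le => N.
have [m xw] := hx N.
have c0 : 0 < 2 ^+ (m + 2 ^ N) :> R by rewrite exprn_gt0.
have AP := near_AP_windows _ _ _ xw.
exists [fset x in mkseq (fun i => (2 ^+ (m + i.+1) / x (m + i.+1)%N)%R) (2 ^ N)]%fset; split.
- move=> y /=; rewrite in_fset => /mapP[i].
  rewrite mem_iota add0n => /andP[_ iN] ->.
  have [x0 _] := windowP _ _ _ (xw _ iN).
  exists (pi * x (m + i.+1)%N / 2 ^+ (m + i.+1)).
    by exists (m + i.+1)%N => //=; rewrite addnS.
  have cancel_pi (q s z : R) : q != 0 -> s != 0 -> z != 0 -> q / (q * z / s) = s / z.
    by move=> q0 s0 z0; field; rewrite z0 s0 q0.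
  by apply: cancel_pi; rewrite ?expf_neq0 ?gt_eqF ?pi_gt0.
- exact: card_increasing _ _ (near_AP_lt _ _ _ c0 AP).
- exact: perron_factor_near_AP _ _ _ c0 AP.
Qed.

Lemma uniform_prob_itv (a b : R) : 0 <= a -> a <= b -> b <= 1 ->
  uniform_prob (@ltr01 R) `[a, b]%classic = (b - a)%:E.
Proof.
move=> a0 ab b1; rewrite /uniform_prob.
rewrite (eq_integral (cst 1%E)); last first.
  move=> x; rewrite inE/= in_itv/= => /andP[ax xb].
  by rewrite /uniform_pdf (le_trans a0 ax) (le_trans xb b1)/= subr0 invr1.
rewrite integral_cst//= mul1e lebesgue_measure_itv/= lte_fin.
case: ltgtP ab => //; last by move=> -> _; rewrite subrr.
Qed.

(** For i < n the upper end of the window is at most 2^(i+1) / 2^n, so the whole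
    window is inside [0, 1]. *)
Lemma uniform_prob_window_gt0 n i : (i < n)%N ->
  (0 < uniform_prob (@ltr01 R) (window n i))%E.
Proof.
move=> iN.
have p0 : 0 < 2 ^+ n :> R by rewrite exprn_gt0.
have q0 : 0 < 2 ^+ i.+1 :> R by rewrite exprn_gt0.
have i0 : 1 <= i.+1%:R :> R by rewrite ler1n.
have b0 : 0 < 2 ^+ n * i.+1%:R :> R by rewrite mulr_gt0//; lra.
have a0 : 0 < 2 ^+ n * (i.+1%:R + 2^-1) :> R by rewrite mulr_gt0//; lra.
have lt : 2 ^+ i.+1 / (2 ^+ n * (i.+1%:R + 2^-1)) < 2 ^+ i.+1 / (2 ^+ n * i.+1%:R) :> R.
  by rewrite ltr_pM2l// ltf_pV2 ?posrE// ltr_pM2l//; lra.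
rewrite uniform_prob_itv.
- by rewrite lte_fin subr_gt0.
- by rewrite divr_ge0// ltW.
- exact: ltW.
- rewrite ler_pdivrMr// mul1r.
  have : 2 ^+ i.+1 <= 2 ^+ n :> R by rewrite ler_eXn2l// ltr1n.
  by move/le_trans; apply; rewrite ler_peMr// ltW.
Qed.

End Windows.

(** * Independent events of equal positive probability *)

Section Probability.
Context {d : measure_display} {T : measurableType d} {R : realType}.
Context {P : probability T R}.

Section Events.
Variables (A : nat -> set T) (p : R).
Hypothesis mA : forall b, measurable (A b).
Hypothesis PA : forall s : seq nat, uniq s ->
  P (\bigcap_(b in [set` s]) A b) = (p ^+ size s)%:E.

(** Independence passes to complements.  The induction removes one complement at
    a time, P(E minus A_m) = P(E) - P(E and A_m), and in the second term A_m
    joins the events that are required to hold: hence the extra list s, whose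
    members must avoid the indices below m. *)
Lemma probability_inter_complements (m : nat) (s : seq nat) :
  uniq s -> all (leq m) s ->
  P (\bigcap_(b in [set` s]) A b `&` \bigcap_(b < m) ~` A b) =
  (p ^+ size s * (1 - p) ^+ m)%:E.
Proof.
have mcap (s' : seq nat) : measurable (\bigcap_(b in [set` s']) A b).
  by apply: fin_bigcap_measurable => //; exact: finite_seq.
elim: m s => [|m IH] s us ms.
  by rewrite bigcap_mkord big_ord0 setIT PA// expr0 mulr1.
have mC : measurable (\bigcap_(b < m) ~` A b).
  by apply: bigcap_measurableType => b _; exact: measurableC.
have -> : \bigcap_(b in [set` s]) A b `&` \bigcap_(b < m.+1) ~` A b =
    (\bigcap_(b in [set` s]) A b `&` \bigcap_(b < m) ~` A b) `\` A m.
  by rewrite !bigcap_mkord big_ord_recr/= setIA setDE.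
have mE := measurableI _ _ (mcap s) mC.
rewrite measureD//; last by rewrite -ge0_fin_numE// fin_num_measure.
have -> : \bigcap_(b in [set` s]) A b `&` \bigcap_(b < m) ~` A b `&` A m =
    \bigcap_(b in [set` m :: s]) A b `&` \bigcap_(b < m) ~` A b.
  by rewrite setIAC !bigcap_seq big_cons [A m `&` _]setIC.
have ms' : all (leq m) s by apply: sub_all ms => b; exact: ltnW.
have mus : uniq (m :: s).
  by rewrite /= us andbT; apply/negP => /(allP ms); rewrite ltnn.
have mms : all (leq m) (m :: s) by rewrite /= leqnn.
rewrite (_ : (_ - _)%E = (p ^+ size s * (1 - p) ^+ m)%:E -
                         (p ^+ (size s).+1 * (1 - p) ^+ m)%:E)%E.
  by rewrite -EFinB; congr EFin; rewrite !exprS; ring.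
exact: (congr2 (fun x y : \bar R => (x - y)%E) (IH s us ms') (IH _ mus mms)).
Qed.

(** The probability that none of the first m events occurs is (1 - p)^m, which
    tends to 0. *)
Lemma ae_some_event : 0 < p -> {ae P, forall w, exists b, A b w}.
Proof.
move=> p0.
have p1 : p <= 1.
  have := PA [:: 0%N] isT; rewrite expr1 -lee_fin => <-.
  apply: probability_le1.
  by apply: fin_bigcap_measurable => //; exact: finite_seq.
have mN : measurable (\bigcap_b ~` A b).
  by apply: bigcapT_measurable => b; exact: measurableC.
exists (\bigcap_b ~` A b); split => //; last first.
  by move=> w /= nA b _ Ab; apply: nA; exists b.
have PN m : (P (\bigcap_b ~` A b) <= ((1 - p) ^+ m)%:E)%E.
  have := probability_inter_complements m [::] isT isT.
  rewrite classical_sets.set_nil bigcap_set0 setTI mul1r => <-.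
  apply: le_measure; rewrite ?inE//.
    by apply: bigcap_measurableType => b _; exact: measurableC.
  by move=> w Aw b _; exact: Aw.
apply/eqP; rewrite eq_le measure_ge0 andbT.
have cv : ((1 - p) ^+ m)%:E @[m --> \oo] --> (0%:E : \bar R).
  by apply: cvg_EFin; [exact: nearW | apply: cvg_expr; rewrite ger0_norm; lra].
have <- : limn (fun m => ((1 - p) ^+ m)%:E) = (0%E : \bar R) by exact: cvg_lim cv.
apply: lime_ge; first by apply/cvg_ex; eexists; exact: cv.
exact: nearW.
Qed.

End Events.

(** * Blocks of independent variables *)

Section Blocks.
Variable X : nat -> {RV P >-> R}.
Hypothesis X_indep : independent_RVs [set k : nat | (1 <= k)%N] X.

Lemma independent_RVs_seq (r : seq nat) (B : nat -> set R) :
  uniq r -> {in r, forall k, 1 <= k}%N -> (forall k, measurable (B k)) ->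
  P (\bigcap_(k in [set` r]) (X k @^-1` B k)) =
  (\prod_(k <- r) P (X k @^-1` B k))%E.
Proof.
move=> ur r1 mB.
have := X_indep [fset k in r]%fset B.
have -> : [set` [fset k in r]%fset] = [set` r].
  by apply/seteqP; split => k /=; rewrite in_fset.
move=> -> //; last first.
apply: perm_big; apply: uniq_perm => //.
by move=> k; exact: in_fset.
Qed.

(** The shift i + 1 keeps index 0, of which nothing is assumed, out of the
    blocks. *)
Definition block_event (n : nat) (B : nat -> set R) (b : nat) : set T :=
  \bigcap_(i < n) (X (b * n + i.+1)%N @^-1` B i).

Lemma measurable_block_event n B b : (forall i, measurable (B i)) ->
  measurable (block_event n B b).
Proof.
move=> mB; apply: bigcap_measurableType => i _.
rewrite -[X in measurable X]setTI; exact: measurable_funP.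
Qed.

Hypothesis X_unif : forall k : nat, (1 <= k)%N -> uniform01 (X k).

(** An intersection of block events over distinct blocks constrains distinct
    variables, so its probability is a product over blocks and positions; by
    identical distribution the factor of a block does not depend on the block. *)
Lemma probability_block_events n B (s : seq nat) : uniq s ->
  (forall i, measurable (B i)) ->
  P (\bigcap_(b in [set` s]) block_event n B b) =
  ((\prod_(i < n) fine (uniform_prob (@ltr01 R) (B i))) ^+ size s)%:E.
Proof.
move=> us mB.
pose r := [seq (b * n + i.+1)%N | b <- s, i <- iota 0 n].
(* The constraint on X k, read off from the position of k in its block. *)
pose C k := B (k.-1 %% n)%N.
have CE b i : (i < n)%N -> C (b * n + i.+1)%N = B i.
  by move=> iN; rewrite /C addnS/= modnMDl modn_small.
have -> : \bigcap_(b in [set` s]) block_event n B b =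
    \bigcap_(k in [set` r]) (X k @^-1` C k).
  apply/seteqP; split => w /= h.
    move=> k /allpairsP[[b i] /= [bs]]; rewrite mem_iota => /andP[_ iN] ->{k}.
    by rewrite /= CE//; exact: h.
  move=> b bs i /= iN; rewrite -(CE b)//; apply: (h (b * n + i.+1)%N).
  by apply: allpairs_f => //; rewrite mem_iota.
rewrite independent_RVs_seq//; last 3 first.
- rewrite allpairs_uniq ?iota_uniq// => -[b i] [b' i'] /=.
  move=> /allpairsP[[? j] /= [_ + [-> ->]]] /allpairsP[[? j'] /= [_ + [-> ->]]].
  rewrite !mem_iota !add0n /= => jn j'n e.
  have n0 : (0 < n)%N by exact: leq_ltn_trans jn.
  move: e; rewrite !addnS => -[e].
  congr pair.
    by move: (congr1 (divn^~ n) e); rewrite !divnMDl// !divn_small// !addn0.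
  by move: (congr1 (modn^~ n) e); rewrite !modnMDl !modn_small.
- by move=> k /allpairsP[[b i] /= [_ _ ->]]; rewrite addnS.
- by move=> k; exact: mB.
rewrite /r big_allpairs_dep.
rewrite (eq_bigr (fun=> (\prod_(i < n) fine (uniform_prob (@ltr01 R) (B i)))%:E)); last first.
  move=> b _; rewrite -prodEFin -{1}[n]subn0 big_mkord.
  apply: eq_bigr => i _; rewrite CE// fineK.
    by rewrite -(X_unif (b * n + i.+1)) ?addnS; last exact: mB.
  by rewrite fin_num_measure; last exact: mB.
by rewrite prodEFin big_const_seq count_predT iter_mulr_1.
Qed.

End Blocks.
End Probability.

Theorem theorem9 (d : measure_display) (T : measurableType d) (R : realType)
    (P : probability T R) (X : nat -> {RV P >-> R})
    (X_indep : independent_RVs [set k : nat | (1 <= k)%N] X)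
    (X_unif : forall k : nat, (1 <= k)%N -> uniform01 (X k)) :
  {ae P, forall w : T,
    (perron_capacity (Omega_rand_lac (fun k => X k w)) < +oo)%E}.
Proof.
have key : {ae P, forall w, forall N, exists b,
    block_event X (2 ^ N) (window (2 ^ N)) b w}.
  apply: ae_foralln => N.
  have mW i : measurable (@window R (2 ^ N) i) by exact: measurable_itv.
  apply: ae_some_event.
  - by move=> b; exact: measurable_block_event.
  - by move=> s us; exact: probability_block_events.
  - apply: prodr_gt0 => i _; apply: fine_gt0.
    rewrite uniform_prob_window_gt0//= -ge0_fin_numE//.
    by rewrite fin_num_measure; last exact: mW.
apply: filterS key => w hw.
apply: (@le_lt_trans _ _ 6%:E); last exact: ltry.
apply: perron_capacity_windows => N; have [b bw] := hw N.
by exists (b * 2 ^ N)%N => i iN; exact: bw.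
Qed.
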